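(* Let $m>0$ and let $\Sigma$ be a smooth spacelike graph $t=u(r,\mathbf y)$ of a bounded function $u$ in Region I (i.e. $r>2m$) of the Kruskal extension of Schwarzschild spacetime, such that $\Sigma$ can be extended to be a smooth spacelike surface near $T=X=0$ so that $T$ is a smooth function of $X,\mathbf y$ on it. Let $\eta=\left(1-\frac{2m}r\right)^{\frac12}$, and suppose $u_\eta\ne0$ at $r=2m$. Then the inner boundary $\partial\Sigma$ of $\Sigma$ (at $r=2m$) is totally geodesic in $\Sigma$. In particular, $\partial\Sigma$ is totally geodesic for a spacelike constant mean curvature surface $\Sigma$ that is the graph of a bounded function in Region I and can be extended to be a smooth spacelike surface near $T=X=0$ so that $T$ is a smooth function of $X,\mathbf y$ on it.
   Context: $\mathbf y\in\mathbb S^2$ (unit sphere, standard metric $\sigma$). The Kruskal extension has coordinates $(T,X,\mathbf y)$ and metric $\frac{32m^3}{r}\exp(-\frac r{2m})(-dT^2+dX^2)+r^2\sigma$, where $r=r(T,X)$ is given by $X^2-T^2=(\frac r{2m}-1)\exp(\frac r{2m})$. Region I is $X>0$, $X^2-T^2>0$ (so $r>2m$); there the metric is $g_{\mathrm{Sch}}=-(1-\frac{2m}r)dt^2+(1-\frac{2m}r)^{-1}dr^2+r^2\sigma$ with $T=(\frac r{2m}-1)^{1/2}e^{r/4m}\sinh\frac t{4m}$, $X=(\frac r{2m}-1)^{1/2}e^{r/4m}\cosh\frac t{4m}$. Under the stated assumption $u$ is smooth up to $\eta=0$ as a function of $(\eta,\mathbf y)$. $\partial\Sigma=\{(t,r,\mathbf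 y)=(u(2m,\mathbf y),2m,\mathbf y):\mathbf y\in\mathbb S^2\}$ is the inner boundary of $\Sigma$, corresponding in Kruskal coordinates to $T=X=0$; $\Sigma$ carries the metric induced by the spacetime metric. *)

(* Defs.v *)
From mathcomp Require Import all_boot all_order all_algebra.
From mathcomp Require Import all_classical all_reals all_analysis.

Set Implicit Arguments.
Unset Strict Implicit.
Unset Printing Implicit Defensive.

Import Order.TTheory GRing.Theory Num.Theory.
Import numFieldNormedType.Exports.

Local Open Scope classical_set_scope.
Local Open Scope ring_scope.

Section SmoothMaps.
Context {R : realType} {n : nat} {W : normedModType R}.
Implicit Types (U : set 'rV[R]_n) (f : 'rV[R]_n -> W).

Definition partial (i : 'I_n) f : 'rV[R]_n -> W :=
  fun x => 'D_(delta_mx 0 i) f x.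

Fixpoint Ck_on (k : nat) U f : Prop :=
  (forall x, U x -> {for x, continuous f}) /\
  if k is k'.+1 then
    forall i : 'I_n,
      (forall x, U x -> derivable f x (delta_mx 0 i)) /\ Ck_on k' U (partial i f)
  else True.

(* Meant for open U: derivatives at x in U only see f on U. *)
Definition smooth_on U f : Prop := forall k, Ck_on k U f.

End SmoothMaps.

(* A semi-Riemannian metric on (an open subset of) R^n is given by its Gram
   matrix; F : R^k -> R^n is a parametrized submanifold. *)
Section SemiRiemannian.
Context {R : realType} {n k : nat}.
Implicit Types (g : 'rV[R]_n -> 'M[R]_n) (F : 'rV[R]_k -> 'rV[R]_n).
Implicit Types (x : 'rV[R]_k) (v : 'rV[R]_n).

Definition inner (G : 'M[R]_n) (v w : 'rV[R]_n) : R := (v *m G *m w^T) 0 0.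

Definition pos_def (G : 'M[R]_n) : Prop :=
  forall v : 'rV[R]_n, v != 0 -> 0 < inner G v v.

Definition christoffel g (p : 'rV[R]_n) (a b c : 'I_n) : R :=
  2^-1 * \sum_(d < n) invmx (g p) a d *
    (partial b (fun q => g q d c) p + partial c (fun q => g q d b) p
     - partial d (fun q => g q b c) p).

Definition induced_metric g F x : 'M[R]_k :=
  \matrix_(i, j) inner (g (F x)) (partial i F x) (partial j F x).

(* The ambient covariant derivative of the coordinate field d_j F along d_i F. *)
Definition cov_deriv g F (i j : 'I_k) x : 'rV[R]_n :=
  \row_a (partial i (partial j F) x 0 a
    + \sum_(b < n) \sum_(c < n) christoffel g (F x) a b c
        * partial i F x 0 b * partial j F x 0 c).

Definition normal_at g F x v : Prop :=
  forall i : 'I_k, inner (g (F x)) v (partial i F x) = 0.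

(* For v normal at x, the component along v of the second fundamental form. *)
Definition second_fund_form g F x v : 'M[R]_k :=
  \matrix_(i, j) inner (g (F x)) (cov_deriv g F i j x) v.

Definition totally_geodesic_on g F (U : set 'rV[R]_k) : Prop :=
  forall x, U x -> forall v, normal_at g F x v -> second_fund_form g F x v = 0.

End SemiRiemannian.

Section Hypersurface.
Context {R : realType} {n k : nat}.
Implicit Types (g : 'rV[R]_n -> 'M[R]_n) (F : 'rV[R]_k -> 'rV[R]_n).

Definition spacelike_on g F (U : set 'rV[R]_k) : Prop :=
  forall x, U x -> pos_def (induced_metric g F x).

Definition mean_curvature g F (x : 'rV[R]_k) (nu : 'rV[R]_n) : R :=
  \tr (invmx (induced_metric g F x) *m second_fund_form g F x nu).

End Hypersurface.

Section Sphere.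
Context {R : realType}.

(* The library norm `|y| on 'rV[R]_3 is the sup norm, hence the explicit sum. *)
Definition unit_sphere : set 'rV[R]_3 := [set y | \sum_(i < 3) y 0 i ^+ 2 = 1].

(* A local parametrization of the sphere, i.e. the inverse of a chart. *)
Definition sphere_param (V : set 'rV[R]_2) (phi : 'rV[R]_2 -> 'rV[R]_3) : Prop :=
  [/\ open V,
      smooth_on V phi,
      forall x, V x -> unit_sphere (phi x),
      forall x, V x -> row_free (\matrix_(i < 2) partial i phi x) &
      forall x x', V x -> V x' -> phi x = phi x' -> x = x'].

(* The standard metric sigma in the coordinates given by phi. *)
Definition round_metric (phi : 'rV[R]_2 -> 'rV[R]_3) : 'rV[R]_2 -> 'M[R]_2 :=
  induced_metric (fun=> 1%:M) phi.

End Sphere.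

Section Spacetime.
Context {R : realType}.
Variable m : R.
Implicit Types (phi : 'rV[R]_2 -> 'rV[R]_3) (T X r t : R).

Definition row2 (a b : R) : 'rV[R]_2 := row_mx (a%:M : 'M[R]_1) (b%:M : 'M[R]_1).

Definition sinh (x : R) : R := (expR x - expR (- x)) / 2.
Definition cosh (x : R) : R := (expR x + expR (- x)) / 2.

(* The area radius, for X ^+ 2 - T ^+ 2 > -1. *)
Definition kruskal_r T X : R :=
  xget 0 [set r | 0 < r /\
    X ^+ 2 - T ^+ 2 = (r / (2 * m) - 1) * expR (r / (2 * m))].

(* Coordinates (T, X, x), where x in R^2 stands for the point phi x. *)
Definition kruskal_metric phi (p : 'rV[R]_(2 + 2)) : 'M[R]_(2 + 2) :=
  let r := kruskal_r (p 0 0) (p 0 1) in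
  let A := 32 * m ^+ 3 / r * expR (- (r / (2 * m))) in
  block_mx (diag_mx (row2 (- A) A)) 0 0 (r ^+ 2 *: round_metric phi (rsubmx p)).

(* Coordinates (t, r, x), for r > 2 m. *)
Definition schwarzschild_metric phi (p : 'rV[R]_(2 + 2)) : 'M[R]_(2 + 2) :=
  let r := p 0 1 in
  let f := 1 - 2 * m / r in
  block_mx (diag_mx (row2 (- f) f^-1)) 0 0 (r ^+ 2 *: round_metric phi (rsubmx p)).

Definition kruskal_T t r : R :=
  Num.sqrt (r / (2 * m) - 1) * expR (r / (4 * m)) * sinh (t / (4 * m)).
Definition kruskal_X t r : R :=
  Num.sqrt (r / (2 * m) - 1) * expR (r / (4 * m)) * cosh (t / (4 * m)).

End Spacetime.

Section GraphInRegionI.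
Context {R : realType}.
Variables (m : R) (u : R -> 'rV[R]_3 -> R).
Implicit Types (phi : 'rV[R]_2 -> 'rV[R]_3) (V : set 'rV[R]_2).

(* Points of R x S^2 have coordinates q = (q 0 0, rsubmx q). *)
Definition cylinder (I : set R) (V : set 'rV[R]_2) : set 'rV[R]_(1 + 2) :=
  [set q : 'rV[R]_(1 + 2) | I (q 0 0) /\ V (rsubmx q)].

Definition exterior V := cylinder [set r | 2 * m < r] V.

Definition graph phi (q : 'rV[R]_(1 + 2)) : 'rV[R]_(2 + 2) :=
  row_mx (row2 (u (q 0 0) (phi (rsubmx q))) (q 0 0)) (rsubmx q).

Definition smooth_graph : Prop :=
  forall V phi, sphere_param V phi ->
    smooth_on (exterior V) (fun q => u (q 0 0) (phi (rsubmx q))).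

Definition bounded_graph : Prop :=
  exists C : R, forall r y, 2 * m < r -> unit_sphere y -> `|u r y| <= C.

Definition spacelike_graph : Prop :=
  forall V phi, sphere_param V phi ->
    spacelike_on (schwarzschild_metric m phi) (graph phi) (exterior V).

Definition future_unit_normal phi (q : 'rV[R]_(1 + 2)) (nu : 'rV[R]_(2 + 2)) : Prop :=
  let g := schwarzschild_metric m phi in
  [/\ normal_at g (graph phi) q nu,
      inner (g (graph phi q)) nu nu = -1 &
      0 < nu 0 0].

Definition constant_mean_curvature : Prop :=
  exists H : R, forall V phi, sphere_param V phi ->
    forall q, exterior V q -> forall nu, future_unit_normal phi q nu ->
      mean_curvature (schwarzschild_metric m phi) (graph phi) q nu = H.

Definition surface (T X : R) (y : 'rV[R]_3) : Prop :=
  exists r, [/\ 2 * m < r, T = kruskal_T m (u r y) r & X = kruskal_X m (u r y) r].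

(* Inverse of eta = sqrt (1 - 2 m / r). *)
Definition radius_of_eta (eta : R) : R := 2 * m / (1 - eta ^+ 2).

Definition u_horizon (y : 'rV[R]_3) : R :=
  lim (u (radius_of_eta eta) y @[eta --> 0^'+]).

(* u_eta at eta = 0, for u continued by u_horizon to eta = 0. *)
Definition u_eta_horizon (y : 'rV[R]_3) : R :=
  lim ((u (radius_of_eta eta) y - u_horizon y) / eta @[eta --> 0^'+]).

End GraphInRegionI.

Section Extension.
Context {R : realType}.
Variables (m eps : R) (F : R -> 'rV[R]_3 -> R).
Implicit Types (phi : 'rV[R]_2 -> 'rV[R]_3) (V : set 'rV[R]_2).

Definition collar V := cylinder [set X : R | `|X| < eps] V.

(* T = F X y, |X| < eps, is a smooth spacelike surface of the Kruskal spacetime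
   that agrees with the graph t = u r y where 0 < X < eps. *)
Definition kruskal_extension (u : R -> 'rV[R]_3 -> R) : Prop :=
  [/\ 0 < eps,
      forall V phi, sphere_param V phi ->
        smooth_on (collar V) (fun q => F (q 0 0) (phi (rsubmx q))),
      forall X y, `|X| < eps -> unit_sphere y -> -1 < X ^+ 2 - F X y ^+ 2,
      forall V phi, sphere_param V phi ->
        spacelike_on (kruskal_metric m phi) (graph F phi) (collar V) &
      forall T X y, 0 < X < eps -> unit_sphere y ->
        (surface m u T X y <-> T = F X y)].

(* In the coordinates (X, x) of the surface T = F X y the inner boundary is
   X = 0; there T = F 0 y = 0 by continuity when u is bounded, because
   T / X = tanh (u / 4 m) on the graph. *)
Definition boundary_totally_geodesic : Prop :=
  forall V phi, sphere_param V phi ->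
    totally_geodesic_on
      (induced_metric (kruskal_metric m phi) (graph F phi))
      (fun x : 'rV[R]_2 => row_mx (0 : 'M[R]_1) x : 'rV[R]_(1 + 2)) V.

End Extension.

(* Main.v *)
Require Import Defs.
From mathcomp Require Import all_boot all_order all_algebra.
From mathcomp Require Import all_classical all_reals all_analysis.
From mathcomp Require Import ring lra.
Set Implicit Arguments.
Unset Strict Implicit.
Unset Printing Implicit Defensive.

Import Order.TTheory GRing.Theory Num.Theory.
Import numFieldNormedType.Exports.
Local Open Scope classical_set_scope.
Local Open Scope ring_scope.

(** The inner boundary is the bifurcation sphere [T = X = 0] of the Kruskal
    spacetime, and that sphere is totally geodesic in the whole spacetime: the
    area radius depends only on [X ^+ 2 - T ^+ 2], which is stationary at
    [T = X = 0], so to first order the sphere keeps its metric in every normal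
    direction.  A submanifold that is totally geodesic in the spacetime is
    totally geodesic in each surface that contains it.

    The surface contains the sphere because the graph over Region I lies in the
    wedge [|T| <= X] ([graph_in_wedge]), hence the continuous function [F]
    vanishes at [X = 0] ([height_slice]).

    The induced metric is computed directly in the coordinates [(X, x)] of the
    surface ([induced_graphE]).  With [f] the height function [T = f (X, x)], a
    conformal factor [A] and the round metric [sigma], its components are
      [h_XX = A (1 - f_X ^+ 2)], [h_Xi = - A f_X f_i] and
      [h_ij = - A f_i f_j + r ^+ 2 sigma_ij].
    As [f] vanishes on the slice [X = 0], so do its derivatives [f_i] along the
    slice.  Therefore [h_Xi = 0] there ([induced_mixed]).  Moreover the
    [X]-derivative of [h_ij] vanishes there ([induced_normal_derivative]): the
    product [f_i f_j] vanishes to second order and [r] is stationary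
    ([kruskal_r_stationary]).  These two facts make any coordinate slice totally
    geodesic ([slice_totally_geodesic]), because its second fundamental form is
    [- h_ij,X / 2] up to the normalization of the normal vector. *)

(** * Derivatives along lines *)

(** Turns a directional derivative into a derivative of a function of one real
    variable, to which the chain rule and the inverse function rule apply. *)
Lemma is_derive_lineP (R : realType) (V W : normedModType R) (f : V -> W)
    (a v : V) (d : W) :
  is_derive (0 : R) 1 (fun t : R => f (t *: v + a)) d <-> is_derive a v f d.
Proof.
have E : (fun h : R => h^-1 *: (((fun t : R => f (t *: v + a)) \o shift 0) (h *: 1)
            - f (0 *: v + a)))
       = (fun h : R => h^-1 *: ((f \o shift a) (h *: v) - f a)).
  apply/funext => h /=.
  by rewrite scale0r add0r addr0 [h *: 1]mulr1.
by split=> -[df Df]; split;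
  move: df Df; rewrite /derivable /derive E.
Qed.

Lemma is_derive_affine (R : realType) (V W : normedModType R) (f : V -> W)
    (a v : V) (w : W) :
  (forall t : R, f (t *: v + a) = t *: w + f a) -> is_derive a v f w.
Proof.
move=> fE.
have E : \forall h \near (0 : R)^', h^-1 *: ((f \o shift a) (h *: v) - f a) = w.
  near=> h; rewrite /= fE addrK scalerA mulVf ?scale1r//.
  by near: h; exact: nbhs_dnbhs_neq.
split; first by apply/cvg_ex; exists w; apply: cvg_near_cst.
exact: lim_near_cst.
Unshelve. all: by end_near. Qed.

Lemma near_line (R : realType) (V : normedModType R) (A : set V) (a v : V) :
  open A -> A a -> \forall t \near (0 : R), A (t *: v + a).
Proof.
move=> Ao Aa.
have c : ((t *: v + a) @[t --> (0 : R)]) --> a.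
  rewrite -[X in _ --> X]add0r -(scale0r v).
  by apply: cvgD; [apply: cvgZr_tmp; exact: cvg_id|exact: cvg_cst].
by apply: c; apply: open_nbhs_nbhs.
Qed.

Lemma derive_near0 (R : realType) (V W : normedModType R) (f : V -> W) (a v : V) :
  (\forall t \near (0 : R), f (t *: v + a) = 0) -> 'D_v f a = 0.
Proof.
move=> f0; apply: derive_val; apply/is_derive_lineP.
apply: (near_eq_is_derive (f := cst 0)).
by near=> t; rewrite [RHS](near f0 t).
Unshelve. all: by end_near. Qed.

(** Both summands of the product rule keep a vanishing factor: this is the first
    order part of [f * g] being of second order. *)
Lemma is_derive_vanishing2 (R : realType) (V : normedModType R) (A f g : V -> R)
    (a v : V) (dA df dg : R) :
  is_derive a v A dA -> is_derive a v f df -> is_derive a v g dg ->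
  f a = 0 -> g a = 0 -> is_derive a v (fun x => A x * (f x * g x)) 0.
Proof.
move=> DA Df Dg f0 g0; apply: (is_derive_eq (is_deriveM DA (is_deriveM Df Dg))).
by rewrite mulrfctE f0 g0 !scale0r mulr0 scale0r !addr0 scaler0.
Qed.

Lemma is_derive_mx (R : realType) (V : normedModType R) k n
    (M : V -> 'M[R]_(k, n)) (a v : V) (D : 'M[R]_(k, n)) :
  (forall i j, is_derive a v (fun x => M x i j) (D i j)) -> is_derive a v M D.
Proof.
move=> MD.
have dM : derivable M a v by apply/derivable_mxP => i j; case: (MD i j).
split=> //; rewrite derive_mx//; apply/matrixP => i j; rewrite mxE.
exact: derive_val.
Qed.

(** * Totally geodesic coordinate slices *)

Lemma innerZ (R : realType) n (c : R) (G : 'M[R]_n) (v w : 'rV[R]_n) :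
  inner (c *: G) v w = c * inner G v w.
Proof. by rewrite /inner -scalemxAr -scalemxAl mxE. Qed.

Lemma inner_sym (R : realType) n (G : 'M[R]_n) (v w : 'rV[R]_n) :
  G^T = G -> inner G v w = inner G w v.
Proof.
move=> Gs; transitivity ((v *m G *m w^T)^T 0 0); first by rewrite [RHS]mxE.
by rewrite !trmx_mul trmxK Gs mulmxA.
Qed.

Lemma inner_delta (R : realType) n (G : 'M[R]_n) (v : 'rV[R]_n) i :
  inner G v (delta_mx 0 i) = (v *m G) 0 i.
Proof. by rewrite /inner trmx_delta -colE mxE. Qed.

Lemma pos_def_unitmx (R : realType) n (G : 'M[R]_n) : pos_def G -> G \in unitmx.
Proof.
move=> Gpos; rewrite -row_free_unit; apply: inj_row_free => v vG0.
apply/eqP/negPn/negP => /Gpos.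
by rewrite /inner vG0 mul0mx mxE ltxx.
Qed.

Section Slice.
Context {R : realType} {k : nat}.
Implicit Types (h : 'rV[R]_(1 + k) -> 'M[R]_(1 + k)).

Definition slice (x : 'rV[R]_k) : 'rV[R]_(1 + k) := row_mx (0 : 'M[R]_1) x.

Lemma delta_rshift (i : 'I_k) :
  delta_mx 0 (rshift 1 i) = row_mx 0 (delta_mx 0 i) :> 'rV[R]_(1 + k).
Proof. by rewrite -delta_mx_rshift. Qed.

Lemma slice_line (t : R) x (i : 'I_k) :
  t *: delta_mx 0 (rshift 1 i) + slice x = slice (t *: delta_mx 0 i + x).
Proof.
by rewrite delta_rshift /slice scale_row_mx add_row_mx scaler0 addr0.
Qed.

Lemma partial_slice (i : 'I_k) : partial i slice = cst (delta_mx 0 (rshift 1 i)).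
Proof.
apply/funext => x; apply: derive_val; apply: is_derive_affine => t.
by rewrite slice_line.
Qed.

(** The tangential part [w] of [v] satisfies [inner G w w = 0], since it differs
    from [v] by a multiple of the first basis vector, orthogonal to the slice. *)
Lemma slice_normalE (G : 'M[R]_(1 + k)) (v : 'rV[R]_(1 + k)) :
  pos_def G -> (forall j, G (lshift k 0) (rshift 1 j) = 0) ->
  (forall i, inner G v (delta_mx 0 (rshift 1 i)) = 0) ->
  rsubmx v = 0.
Proof.
move=> Gpos G0 vn; apply/eqP/negPn/negP => v0.
have : inner G (slice (rsubmx v)) (slice (rsubmx v)) = 0.
  rewrite {1}/slice /inner mxE big_split_ord/= big_ord1.
  rewrite [X in X + _](_ : _ = 0) ?add0r; last first.
    by rewrite /slice tr_row_mx col_mxEu trmx0 [X in _ * X]mxE mulr0.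
  apply: big1 => j _.
  rewrite [X in X * _](_ : _ = 0) ?mul0r//.
  have -> : row_mx 0 (rsubmx v) = v - row_mx (lsubmx v) 0.
    by rewrite -[v in v - _]hsubmxK opp_row_mx add_row_mx subrr oppr0 addr0.
  rewrite mulmxBl mxE -inner_delta vn add0r mxE [X in - X]mxE big_split_ord/= big_ord1.
  rewrite G0 mulr0 add0r big1 ?oppr0// => l _.
  by rewrite row_mxEr mxE mul0r.
move/eqP; apply/negP; rewrite gt_eqF// Gpos//.
apply: contraNneq v0 => /(congr1 rsubmx).
by rewrite /slice row_mxKr linear0 => ->.
Qed.

(** Lowering the index turns the covariant derivative along the slice into the
    Christoffel symbols of the first kind, and only their component along the
    first coordinate meets a normal vector.  In it, [h_0i] is differentiated
    along the slice, where it is constantly [0], and [h_ij] across it. *)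
Lemma slice_totally_geodesic h (V : set 'rV[R]_k) :
  open V ->
  (forall x, V x -> (h (slice x))^T = h (slice x)) ->
  (forall x, V x -> pos_def (h (slice x))) ->
  (forall x j, V x -> h (slice x) (lshift k 0) (rshift 1 j) = 0) ->
  (forall x i j, V x ->
     partial (lshift k 0) (fun q => h q (rshift 1 i) (rshift 1 j)) (slice x) = 0) ->
  totally_geodesic_on h slice V.
Proof.
move=> Vo hsym hpos h0 dh0 x Vx v vn.
have h0' y j : V y -> h (slice y) (rshift 1 j) (lshift k 0) = 0.
  by move=> Vy; rewrite -hsym// mxE h0.
have vr : rsubmx v = 0.
  apply: (@slice_normalE (h (slice x))) => //; first exact: hpos.
    by move=> j; exact: h0.
  by move=> i; have := vn i; rewrite partial_slice.
apply/matrixP => i j; rewrite !mxE.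
(* [K] is twice the Christoffel symbol of the first kind. *)
pose K := \row_d (partial (rshift 1 i) (fun q => h q d (rshift 1 j)) (slice x)
    + partial (rshift 1 j) (fun q => h q d (rshift 1 i)) (slice x)
    - partial d (fun q => h q (rshift 1 i) (rshift 1 j)) (slice x)).
have K0 : K 0 (lshift k 0) = 0.
  rewrite mxE dh0// subr0 /partial !derive_near0 ?addr0//.
    near=> t; rewrite slice_line h0//.
    by near: t; exact: near_line.
  near=> t; rewrite slice_line h0//.
  by near: t; exact: near_line.
have -> : cov_deriv h slice i j x = 2^-1 *: (K *m (invmx (h (slice x)))^T).
  apply/rowP => a; rewrite !mxE.
  rewrite [X in X + _](_ : _ = 0) ?add0r; last first.
    by rewrite partial_slice [partial _ _ _]derive_cst mxE.
  rewrite (bigD1 (rshift 1 i))//= [X in _ + X]big1 ?addr0; last first.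
    move=> b bi; apply: big1 => c _.
    by rewrite (partial_slice i) mxE (negbTE bi) mulr0 mul0r.
  rewrite (bigD1 (rshift 1 j))//= [X in _ + X]big1 ?addr0; last first.
    by move=> c cj; rewrite (partial_slice j) [X in _ * X]mxE (negbTE cj) mulr0.
  rewrite !partial_slice !mxE !eqxx !mulr1.
  congr (_ * _); apply: eq_bigr => d _.
  by rewrite !mxE mulrC.
rewrite /inner trmx_inv hsym// -scalemxAl mulmxKV; last exact/pos_def_unitmx/hpos.
rewrite -scalemxAl mxE -[v]hsubmxK vr tr_row_mx mxE big_split_ord/= big_ord1 K0 mul0r.
rewrite add0r big1 ?mulr0// => l _.
by rewrite col_mxEd trmx0 [X in _ * X]mxE mulr0.
Unshelve. all: by end_near. Qed.

End Slice.

(** * The area radius near the horizon *)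

Section Radius.
Context {R : realType}.
Variables (m : R).
Hypothesis m_gt0 : 0 < m.

Definition radial (r : R) : R := (r / (2 * m) - 1) * expR (r / (2 * m)).

Lemma radial_lt (r s : R) : 0 < r -> r < s -> radial r < radial s.
Proof.
move=> r0 rs; rewrite /radial.
have m2 : 0 < 2 * m by rewrite mulr_gt0.
have : r / (2 * m) < s / (2 * m) by rewrite ltr_pM2r ?invr_gt0.
have : 0 < r / (2 * m) by rewrite divr_gt0.
move: (r / _) (s / _) => x y {r s rs r0} x0 xy.
(* Dividing by [expR y], the claim is [(x - 1) * expR (x - y) < y - 1]. *)
have -> : x = (x - y) + y by rewrite subrK.
rewrite expRD mulrA ltr_pM2r ?expR_gt0// subrK.
have [x1|x1] := leP x 1.
  have := expR_ge1Dx (x - y) => e1.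
  apply: (@le_lt_trans _ _ ((x - 1) * (1 + (x - y)))).
    by apply: ler_wnM2l => //; lra.
  by rewrite -subr_gt0 (_ : _ - _ = x * (y - x)); [rewrite mulr_gt0// subr_gt0|ring].
apply: (@le_lt_trans _ _ (x - 1)); last by lra.
by rewrite ler_piMr//; [lra|rewrite expR_le1; lra].
Qed.

(** [kruskal_r m T X] is convertible to [radius_of (X ^+ 2 - T ^+ 2)]. *)
Definition radius_of (s : R) : R := xget 0 [set r | 0 < r /\ s = radial r].

Lemma radialK r : 0 < r -> radius_of (radial r) = r.
Proof.
move=> r0; apply: xget_unique => //= s [s0 Es].
case: (ltgtP s r) => // [sr|rs].
- by have := radial_lt s0 sr; rewrite Es ltxx.
- by have := radial_lt r0 rs; rewrite Es ltxx.
Qed.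

Lemma radial_horizon : radial (2 * m) = 0.
Proof. by rewrite /radial divff ?subrr ?mul0r// mulf_neq0// gt_eqF. Qed.

Lemma kruskal_r_horizon : kruskal_r m 0 0 = 2 * m.
Proof.
rewrite -[LHS]/(radius_of _) subrr -radial_horizon radialK//.
by rewrite mulr_gt0.
Qed.

Lemma is_derive_radial (r : R) :
  is_derive r 1 radial (r / (2 * m) ^+ 2 * expR (r / (2 * m))).
Proof.
have D : is_derive r (1 : R) (fun s : R => s / (2 * m)) (2 * m)^-1.
  apply: is_derive_affine => t; rewrite mulrDl; congr (_ + _).
  by rewrite [t *: 1]mulr1.
have De : is_derive r (1 : R) (fun s : R => expR (s / (2 * m)))
    (expR (r / (2 * m)) * (2 * m)^-1).
  exact: is_derive1_comp.
have Dc : is_derive r (1 : R) (fun s : R => s / (2 * m) - 1) ((2 * m)^-1 - 0).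
  exact: (is_deriveB D (is_derive_cst (1 : R) r (1 : R))).
apply: (is_derive_eq (is_deriveM (f := fun s : R => s / (2 * m) - 1)
  (g := fun s : R => expR (s / (2 * m))) Dc De)).
rewrite /GRing.scale/=; by field; rewrite gt_eqF.
Qed.

Lemma is_derive_radius_of_horizon : exists d, is_derive (0 : R) 1 radius_of d.
Proof.
have m2 : 0 < 2 * m by rewrite mulr_gt0.
have Dh := is_derive_radial (2 * m).
eexists; rewrite -[X in is_derive X]radial_horizon.
apply: (is_derive_inverse _ _ Dh).
- by near=> r; apply: radialK; near: r; exact: lt_nbhsr.
- near=> r; apply: differentiable_continuous; apply/derivable1_diffP.
  by have [] := is_derive_radial r.
- by rewrite mulf_neq0 ?gt_eqF ?expR_gt0// divr_gt0// exprn_gt0.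
Unshelve. all: by end_near. Qed.

(** By the chain rule, since [X ^+ 2 - f X ^+ 2] is stationary at [X = 0]. *)
Lemma kruskal_r_stationary (f : R -> R) d :
  is_derive (0 : R) 1 f d -> f 0 = 0 ->
  is_derive (0 : R) 1 (fun X => kruskal_r m (f X) X) 0.
Proof.
move=> Df f0; have [d' Dr] := is_derive_radius_of_horizon.
have Ds : is_derive (0 : R) 1 (fun X => X ^+ 2 - f X ^+ 2) 0.
  have D1 : is_derive (0 : R) 1 (fun X : R => X ^+ 2) _ :=
    is_deriveX 2 (is_derive_id (0 : R) 1).
  have D2 : is_derive (0 : R) 1 (fun X : R => f X ^+ 2) _ := is_deriveX 2 Df.
  apply: (is_derive_eq (is_deriveB D1 D2)).
  by rewrite f0 !expr1 !mulr0 !scale0r subrr.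
apply: (is_derive_eq _ (mulr0 d')).
apply: (is_derive1_comp (f := radius_of)
   (g := fun X => X ^+ 2 - f X ^+ 2)).
by rewrite f0 expr0n subrr.
Qed.

(** [- conformal r] and [conformal r] are the components [g_TT] and [g_XX] of
    the Kruskal metric. *)
Definition conformal (r : R) : R := 32 * m ^+ 3 / r * expR (- (r / (2 * m))).

Lemma conformal_derivable (c : R -> R) d :
  is_derive (0 : R) 1 c d -> 0 < c 0 ->
  exists e, is_derive (0 : R) 1
    (fun t => conformal (c t)) e.
Proof.
move=> Dc c0.
have DV : is_derive (0 : R) 1 (fun t => 32 * m ^+ 3 / c t) ((32 * m ^+ 3) *: (- (c 0) ^- 2 *: d)).
  apply: is_deriveZ; apply: is_deriveV => //; by rewrite gt_eqF.
have Dm : is_derive (0 : R) 1 (fun t => - (c t / (2 * m))) (- ((2 * m)^-1 *: d)).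
  apply: is_deriveN.
  have -> : (fun x : R => c x / (2 * m)) = (2 * m)^-1 \*: c.
    by apply/funext => t /=; rewrite mulrC.
  exact: is_deriveZ.
have DE := is_derive1_comp (f := expR) (g := fun t => - (c t / (2 * m)))
  (is_derive_expR _) Dm.
by eexists; exact: (is_deriveM DV DE).
Qed.

End Radius.

(** * The induced metric of a graph in the Kruskal spacetime *)

Section Graph.
Context {R : realType}.
Variables (m : R) (F : R -> 'rV[R]_3 -> R) (phi : 'rV[R]_2 -> 'rV[R]_3).
Implicit Types (q v : 'rV[R]_(1 + 2)).

Definition height q : R := F (q 0 0) (phi (rsubmx q)).

Lemma row2E0 (a b : R) : row2 a b 0 0 = a.
Proof.
transitivity (row2 a b 0 (lshift 1 (0 : 'I_1))); first by congr (row2 a b 0 _); exact: val_inj.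
by apply: etrans (row_mxEl (a%:M) (b%:M) 0 0) _; rewrite mxE.
Qed.

Lemma row2E1 (a b : R) : row2 a b 0 1 = b.
Proof.
transitivity (row2 a b 0 (rshift 1 (0 : 'I_1))); first by congr (row2 a b 0 _); exact: val_inj.
by apply: etrans (row_mxEr (a%:M) (b%:M) 0 0) _; rewrite mxE.
Qed.

Lemma row_mx_row2E0 (a b : R) (w : 'rV[R]_2) : row_mx (row2 a b) w 0 0 = a.
Proof.
by rewrite (_ : 0 = lshift 2 0 :> 'I_(2 + 2)) ?row_mxEl ?row2E0//; exact: val_inj.
Qed.

Lemma row_mx_row2E1 (a b : R) (w : 'rV[R]_2) : row_mx (row2 a b) w 0 1 = b.
Proof.
by rewrite (_ : 1 = lshift 2 1 :> 'I_(2 + 2)) ?row_mxEl ?row2E1//; exact: val_inj.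
Qed.

Lemma inner_block (a b p p' s s' : R) (S : 'M[R]_2) (w w' : 'rV[R]_2) :
  inner (block_mx (diag_mx (row2 a b)) 0 0 S)
    (row_mx (row2 p s) w) (row_mx (row2 p' s') w')
  = a * p * p' + b * s * s' + inner S w w'.
Proof.
have diagE (v d : 'rV[R]_2) i : (v *m diag_mx d) 0 i = v 0 i * d 0 i.
  by rewrite mul_mx_diag mxE.
have trE (v : 'rV[R]_2) i : v^T i 0 = v 0 i by rewrite mxE.
rewrite /inner mul_row_block !mulmx0 add0r addr0 tr_row_mx mul_row_col mxE.
congr (_ + _); rewrite mxE big_ord_recl big_ord1 !diagE !trE.
rewrite (_ : lift ord0 ord0 = 1) ?row2E0 ?row2E1; last exact: val_inj.
by rewrite (mulrC a) (mulrC b).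
Qed.

Lemma is_derive_graph q v : derivable height q v ->
  is_derive q v (graph F phi) (row_mx (row2 ('D_v height q) (v 0 0)) (rsubmx v)).
Proof.
move=> /derivableP dh; apply: is_derive_mx => i j; rewrite ord1 {i}.
rewrite -[j]splitK; case: fintype.split => {}j /=.
  rewrite row_mxEl.
  rewrite (_ : (fun x => _) = fun x => row2 (height x) (x 0 0) 0 j); last first.
    by apply/funext => x; rewrite row_mxEl.
  have [->|->] : j = 0 \/ j = 1.
    by case: j => -[|[|//]] ?; [left|right]; exact: val_inj.
  - rewrite row2E0 (_ : (fun x => _) = height) //.
    by apply/funext => x; rewrite row2E0.
  - rewrite row2E1; apply: is_derive_affine => t.
    by rewrite !row2E1 !mxE.
rewrite row_mxEr; apply: is_derive_affine => t.
by rewrite !row_mxEr linearP/= !mxE.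
Qed.

(** The entry [0] and the right block of a basis vector single out the [X]
    direction and the directions of the sphere, so that a single formula covers
    [h_XX], [h_Xi] and [h_ij]. *)
Lemma induced_graphE q i j :
  derivable height q (delta_mx 0 i) -> derivable height q (delta_mx 0 j) ->
  let r := kruskal_r m (height q) (q 0 0) in
  induced_metric (kruskal_metric m phi) (graph F phi) q i j =
    conformal m r * ((delta_mx 0 i : 'rV[R]_(1 + 2)) 0 0
                   * (delta_mx 0 j : 'rV[R]_(1 + 2)) 0 0
                   - partial i height q * partial j height q)
    + r ^+ 2 * inner (round_metric phi (rsubmx q))
        (rsubmx (delta_mx 0 i : 'rV[R]_(1 + 2)))
        (rsubmx (delta_mx 0 j : 'rV[R]_(1 + 2))).
Proof.
move=> di dj r; rewrite mxE /partial.
rewrite (derive_val (is_derive := is_derive_graph di)).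
rewrite (derive_val (is_derive := is_derive_graph dj)).
rewrite /kruskal_metric /graph row_mx_row2E0 row_mx_row2E1 row_mxKr -/(height q).
rewrite -/r -/(conformal m r) inner_block.
by rewrite innerZ mulrBr !mulrA !mulNr [X in X + _ = _]addrC.
Qed.

End Graph.

(** * The induced metric at the bifurcation sphere *)

Section Horizon.
Context {R : realType}.
Variables (m eps : R) (u F : R -> 'rV[R]_3 -> R).
Hypothesis m_gt0 : 0 < m.

(** On the graph [T / X = tanh (u / 4 m)]. *)
Lemma graph_in_wedge (T X : R) y : surface m u T X y -> `|T| <= X.
Proof.
case=> r [_ -> ->]; rewrite /kruskal_T /kruskal_X /sinh /cosh.
set c := Num.sqrt _ * _; have c0 : 0 <= c by rewrite mulr_ge0 ?sqrtr_ge0 ?expR_ge0.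
have e1 := expR_gt0 (u r y / (4 * m)); have e2 := expR_gt0 (- (u r y / (4 * m))).
rewrite normrM (ger0_norm c0); apply: ler_wpM2l => //.
by rewrite ler_norml; apply/andP; split; lra.
Qed.

Hypothesis ext : kruskal_extension m eps F u.
Variables (V : set 'rV[R]_2) (phi : 'rV[R]_2 -> 'rV[R]_3).
Hypothesis chart : sphere_param V phi.

Local Notation f := (height F phi).

Lemma sliceE0 (x : 'rV[R]_2) : slice x 0 0 = 0 :> R.
Proof.
rewrite (_ : 0 = lshift 2 0 :> 'I_(1 + 2)); last exact: val_inj.
by rewrite row_mxEl mxE.
Qed.

Lemma lineE (t : R) (x : 'rV[R]_2) :
  t *: delta_mx 0 (lshift 2 (0 : 'I_1)) + slice x = row_mx t%:M x.
Proof.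
rewrite -[delta_mx _ _]hsubmxK /slice scale_row_mx add_row_mx; congr row_mx.
  by rewrite addr0; apply/matrixP => i j; rewrite !ord1 !mxE !eqxx mulr1.
apply/rowP => i; rewrite !mxE.
by rewrite mulr0 add0r.
Qed.

Lemma lineE0 (t : R) (x : 'rV[R]_2) : (row_mx t%:M x : 'rV[R]_(1 + 2)) 0 0 = t.
Proof.
rewrite (_ : 0 = lshift 2 0 :> 'I_(1 + 2)); last exact: val_inj.
by rewrite row_mxEl mxE.
Qed.

Lemma slice_line0 (x : 'rV[R]_2) : slice x = row_mx (0 : R)%:M x.
Proof. by rewrite /slice raddf0. Qed.

Lemma collar_slice x : V x -> collar eps V (slice x).
Proof.
case: ext => eps0 _ _ _ _ Vx; split; last by rewrite /slice row_mxKr.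
by rewrite /= sliceE0 normr0.
Qed.

Lemma height_smooth : smooth_on (collar eps V) f.
Proof. by case: ext => _ + _ _ _; apply. Qed.

Lemma height_derivable q i : collar eps V q -> derivable f q (delta_mx 0 i).
Proof. by move=> Cq; have [_ /(_ i)[+ _]] := height_smooth 1%N; apply. Qed.

Lemma partial_height_derivable q i j : collar eps V q ->
  derivable (partial i f) q (delta_mx 0 j).
Proof.
move=> Cq; have [_ /(_ i)[_ [_ /(_ j)[+ _]]]] := height_smooth 2%N; exact.
Qed.

Lemma near_collar x : V x ->
  \forall t \near (0 : R), collar eps V (row_mx t%:M x).
Proof.
case: ext => eps0 _ _ _ _ Vx.
have small : \forall t \near (0 : R), `|t| < eps by exact: nbhs0_lt.
apply: filterS small => t te; split; last by rewrite row_mxKr.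
by rewrite /= lineE0.
Qed.

Lemma is_derive_normal (W : normedModType R) (g : 'rV[R]_(1 + 2) -> W) x d :
  is_derive (0 : R) 1 (fun t : R => g (row_mx t%:M x)) d <->
  is_derive (slice x) (delta_mx 0 (lshift 2 (0 : 'I_1))) g d.
Proof.
apply: iff_trans (is_derive_lineP _ _ _ _).
rewrite (_ : (fun t : R => g (t *: _ + _)) = fun t => g (row_mx t%:M x))//.
by apply/funext => t; rewrite lineE.
Qed.

(** [F] is tied to the graph for [X > 0] only; continuity carries the bound
    [|f| <= X] to [X = 0]. *)
Lemma height_slice x : V x -> f (slice x) = 0.
Proof.
move=> Vx; case: ext => eps0 _ _ _ surf.
have c : f (row_mx t%:M x) @[t --> (0 : R)] --> f (slice x).
  rewrite slice_line0.
  have /derivableP/is_derive_normal[Df _] :=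
    height_derivable (i := lshift 2 (0 : 'I_1)) (collar_slice Vx).
  have : {for (0 : R), continuous (fun t : R => f (row_mx t%:M x))}.
    exact/differentiable_continuous/derivable1_diffP.
  exact.
have {}c : `|f (row_mx t%:M x)| @[t --> (0 : R)^'+] --> `|f (slice x)|.
  by apply: cvg_norm; apply: cvg_at_right_filter.
apply/eqP; rewrite -normr_le0.
have id0 : (t : R) @[t --> (0 : R)^'+] --> (0 : R).
  exact: cvg_at_right_filter.
apply: (ler_cvg_to c id0); near=> t.
have /surf sf : 0 < t < eps by apply/andP; split; near: t; [exact: nbhs_right_gt|exact: nbhs_right_lt].
rewrite /height lineE0 row_mxKr; apply: graph_in_wedge.
by apply/sf => //; case: chart => _ _ + _ _; apply.
Unshelve. all: by end_near. Qed.

Lemma partial_height_slice x i : V x -> partial (rshift 1 i) f (slice x) = 0.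
Proof.
move=> Vx; apply: derive_near0; near=> t; rewrite slice_line height_slice//.
by near: t; apply: near_line => //; case: chart.
Unshelve. all: by end_near. Qed.

Let h := induced_metric (kruskal_metric m phi) (graph F phi).

Lemma round_sym x : (round_metric phi x)^T = round_metric phi x.
Proof.
apply/matrixP => i j; rewrite !mxE; apply: inner_sym.
by rewrite trmx1.
Qed.

Lemma induced_sym x : V x -> (h (slice x))^T = h (slice x).
Proof.
move=> /collar_slice Cx; apply/matrixP => i j; rewrite mxE /h.
rewrite !induced_graphE; try exact: height_derivable.
set a := delta_mx 0 i 0 0; set b := delta_mx 0 j 0 0.
set p := partial i f _; set q := partial j f _.
set s := inner _ _ _; set s' := inner _ _ _.
have -> : s = s' by apply: inner_sym; exact: round_sym.
by move: a b p q => a b p q; rewrite (mulrC a) (mulrC p).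
Qed.

Lemma delta_rE0 i : (delta_mx 0 (rshift 1 i) : 'rV[R]_(1 + 2)) 0 0 = 0.
Proof. by rewrite mxE. Qed.

Lemma induced_mixed x j : V x -> h (slice x) (lshift 2 (0 : 'I_1)) (rshift 1 j) = 0.
Proof.
move=> Vx; have Cx := collar_slice Vx; rewrite /h induced_graphE; try exact: height_derivable.
rewrite delta_rE0 partial_height_slice// !mulr0 subrr mulr0 add0r.
rewrite (_ : rsubmx (delta_mx 0 (lshift 2 (0 : 'I_1))) = 0); last first.
  by apply/rowP => i; rewrite !mxE.
by rewrite /inner !mul0mx [X in _ * X]mxE mulr0.
Qed.

Lemma induced_normal_derivative x i j : V x ->
  partial (lshift 2 (0 : 'I_1)) (fun q => h q (rshift 1 i) (rshift 1 j)) (slice x) = 0.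
Proof.
move=> Vx; have Cx := collar_slice Vx.
apply: derive_val; apply/is_derive_normal.
pose r t := kruskal_r m (f (row_mx t%:M x)) t.
pose P k t := partial (rshift 1 k) f (row_mx t%:M x).
pose c := inner (round_metric phi x) (delta_mx 0 i) (delta_mx 0 j).
apply: (near_eq_is_derive (f := fun t => - (conformal m (r t) * (P i t * P j t)) + c * r t ^+ 2)).
  near=> t.
  have Ct : collar eps V (row_mx t%:M x) by near: t; exact: near_collar.
  rewrite /h induced_graphE; try exact: height_derivable.
  rewrite !delta_rE0 lineE0 !row_mxKr !delta_rshift !row_mxKr -/c -/(r t) /P.
  by rewrite mulr0 sub0r mulrN (mulrC c).
have r0 : r 0 = 2 * m.
  by rewrite /r -slice_line0 height_slice// kruskal_r_horizon.
have Dr : is_derive (0 : R) 1 r 0.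
  apply: kruskal_r_stationary => //; last by rewrite -slice_line0 height_slice.
  by have /derivableP/is_derive_normal := height_derivable (i := lshift 2 (0 : 'I_1)) Cx; exact.
have P0 k : P k 0 = 0 by rewrite /P -slice_line0 partial_height_slice.
have DP k : is_derive (0 : R) 1 (P k)
    ('D_(delta_mx 0 (lshift 2 (0 : 'I_1))) (partial (rshift 1 k) f) (slice x)).
  by apply/is_derive_normal/derivableP/partial_height_derivable.
have [e DA] : exists e, is_derive (0 : R) 1 (fun t => conformal m (r t)) e.
  by apply: conformal_derivable Dr _; rewrite r0 mulr_gt0.
have D1 := is_derive_vanishing2 DA (DP i) (DP j) (P0 i) (P0 j).
have D2 := is_deriveZ c (is_deriveX 2 Dr).
apply: (is_derive_eq (is_deriveD (is_deriveN D1) D2)).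
by rewrite oppr0 add0r scaler0 scaler0.
Unshelve. all: by end_near. Qed.

End Horizon.

Theorem theorem4p2 (R : realType) (m : R) (u : R -> 'rV[R]_3 -> R)
    (eps : R) (F : R -> 'rV[R]_3 -> R)
    (m_gt0 : 0 < m)
    (u_smooth : smooth_graph m u)
    (u_bounded : bounded_graph m u)
    (u_spacelike : spacelike_graph m u)
    (F_extends : kruskal_extension m eps F u) :
  ((forall y, unit_sphere y -> u_eta_horizon m u y <> 0) ->
     boundary_totally_geodesic m F) /\
  (constant_mean_curvature m u -> boundary_totally_geodesic m F).
Proof.
suff bifurcation : boundary_totally_geodesic m F by split.
move=> V phi chart.
have Vo : open V by case: chart.
apply: slice_totally_geodesic => //.
- exact: (induced_sym F_extends chart).
- case: (F_extends) => _ _ _ spacelike _ x Vx.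
  exact/(spacelike V phi chart)/(collar_slice F_extends).
- exact: (induced_mixed F_extends chart).
- exact: (induced_normal_derivative m_gt0 F_extends chart).
Qed.
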